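(* Let $\mathbb{V}$ be an $n$-dimensional vector space over a finite field $\mathbb{F}$ with $q$ elements, with basis $\{\alpha_1,\ldots,\alpha_n\}$, and let $\Gamma(\mathbb{V})$ be its non-zero component graph with respect to this basis. If $q=2$ and $n\ge 3$, then $\Gamma(\mathbb{V})$ is Hamiltonian.
   Context: Let $\theta$ be the null vector of $\mathbb{V}$. Every $\mathbf{a}\in\mathbb{V}$ is written uniquely as $\mathbf{a}=a_1\alpha_1+\cdots+a_n\alpha_n$. The non-zero component graph $\Gamma(\mathbb{V})$ with respect to the basis $\{\alpha_1,\ldots,\alpha_n\}$ is the simple graph with vertex set $\mathbb{V}\setminus\{\theta\}$ in which two distinct vertices $\mathbf{a},\mathbf{b}$ are adjacent if and only if there is at least one $i$ such that the coefficients of $\alpha_i$ in $\mathbf{a}$ and in $\mathbf{b}$ are both non-zero. A graph is Hamiltonian if it contains a cycle passing through all of its vertices, each exactly once. *)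

(* Defs.v *)
From HB Require Import structures.
From mathcomp Require Import all_boot all_order all_algebra all_field.

Set Implicit Arguments.
Unset Strict Implicit.
Unset Printing Implicit Defensive.

Import GRing.Theory.
Local Open Scope ring_scope.

Definition nonnull (F : fieldType) (V : vectType F) := {a : V | a != 0}.

(* [coord alpha i a] is the coefficient of [alpha`_i] in [a] only when [alpha]
   is free and spans [a]; it is meant to be used with a basis of [{:V}]. *)
Definition component_adj (F : fieldType) (V : vectType F) (n : nat)
    (alpha : n.-tuple V) : rel (nonnull V) :=
  fun a b => (a != b) &&
    [exists i : 'I_n,
       (coord alpha i (val a) != 0) && (coord alpha i (val b) != 0)].

Lemma component_adj_sym (F : fieldType) (V : vectType F) (n : nat)
  (alpha : n.-tuple V) : symmetric (component_adj alpha).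
Proof.
move=> a b; rewrite /component_adj eq_sym; congr (_ && _).
by apply: eq_existsb => i; rewrite andbC.
Qed.

Lemma component_adj_irrefl (F : fieldType) (V : vectType F) (n : nat)
  (alpha : n.-tuple V) : irreflexive (component_adj alpha).
Proof. by move=> a; rewrite /component_adj eqxx. Qed.

(* The size condition is needed because [cycle e] also accepts the empty
   sequence and, for symmetric [e], an edge traversed back and forth. *)
Definition hamiltonian (T : eqType) (e : rel T) : Prop :=
  exists c : seq T,
    [/\ (3 <= size c)%N, uniq c, cycle e c & forall x : T, x \in c].

(* Main.v *)
Require Import Defs.
From HB Require Import structures.
From mathcomp Require Import all_boot all_order all_algebra all_field.

Set Implicit Arguments.
Unset Strict Implicit.
Unset Printing Implicit Defensive.

Import GRing.Theory.
Local Open Scope ring_scope.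

(** Over the field with two elements a vector is determined by its support, so
the graph is the graph of nonempty subsets of an [n]-element set in which two
distinct subsets are adjacent when they intersect; subsets are written here as
bit sequences of length [n].

A Hamiltonian path [x, ..., z] on the nonempty subsets of [n] elements yields a
Hamiltonian cycle on those of [n.+1] elements ([lift_spans], [lift_cycle]).
The path itself is followed through the subsets that avoid the new element.  The
subsets containing the new element intersect pairwise, so they may be visited in
any order; the visit starts at [z] plus the new element, which meets [z], and
ends at [x] plus the new element, which meets [x] and closes the cycle.  This
needs [x] and [z] to be distinct, that is, at least two elements; there
[{1}, {1,2}, {2}] is a path, although not a cycle.  Induction starts from this
path, and every step beyond it produces a cycle. *)

(** * Intersecting bit sequences *)

Definition meets (s t : seq bool) := has (fun p => p.1 && p.2) (zip s t).

Lemma meetsxx s : meets s s = has id s.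
Proof. by elim: s => //= b s IHs; rewrite /meets /= andbb -IHs. Qed.

Lemma path_meets_true z w :
  path meets (true :: z) [seq true :: t | t <- w].
Proof. by elim: w z => //= t w IHw z; rewrite IHw. Qed.

(** [c] is a Hamiltonian path in the graph of nonzero bit sequences of
length [n]. *)
Definition spans n (c : seq (seq bool)) :=
  [/\ uniq c, sorted meets c & c =i [pred s | (size s == n) && has id s]].

(** The witness [z, 0, s, x] lists all sequences that follow the new bit [true];
only its two ends matter for adjacency.  The zero sequence occurs in it, since
the singleton of the new element is a vertex too. *)
Definition lift n x s z : seq (seq bool) :=
  [seq false :: t | t <- x :: rcons s z] ++
  [seq true :: t | t <- z :: nseq n false :: rcons s x].

(** All adjacencies inside the second half come from the new bit; the two
junctions are [z] with itself and [x] with itself, which meet because [x] and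
[z] are nonzero. *)
Lemma lift_cycle n x s z :
  spans n (x :: rcons s z) -> cycle meets (lift n x s z).
Proof.
case=> _ path_s mem_s.
have nz t : t \in x :: rcons s z -> has id t by rewrite mem_s => /andP[].
have nz_x : has id x by rewrite nz ?mem_head.
have nz_z : has id z by rewrite nz // inE mem_rcons mem_head orbT.
rewrite /lift [map _ (x :: _)]/= /= rcons_cat cat_path path_map last_map.
rewrite last_rcons /= [path _ _ _]path_s /=.
rewrite {1}/meets /= -/(meets z z) meetsxx nz_z /=.
rewrite rcons_path path_meets_true last_map last_rcons.
by rewrite /meets /= -/(meets x x) meetsxx nz_x.
Qed.

Lemma lift_spans n x s z :
  spans n (x :: rcons s z) -> spans n.+1 (lift n x s z).
Proof.
move=> sp; have cyc := lift_cycle sp; case: sp => uniq_s _ mem_s.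
have consI b : injective (cons b : seq bool -> seq bool) by move=> t u [].
set w := z :: nseq n false :: rcons s x.
have perm_w : perm_eq w (nseq n false :: x :: rcons s z).
  apply/permP => a; rewrite /w /= -!cats1 !count_cat /=.
  rewrite !addn0 addnCA; congr addn.
  by rewrite addnCA [RHS]addnCA [(a z + _)%N]addnC.
have has0 k : has id (nseq k false) = false by elim: k.
have uniq_w : uniq w.
  by rewrite (perm_uniq perm_w) cons_uniq uniq_s mem_s !inE has0 andbF.
split.
- rewrite cat_uniq !map_inj_uniq // uniq_s uniq_w andbT.
  by apply/hasPn => _ /mapP[t _ ->]; apply/negP => /mapP[u _ ].
- by move: cyc; rewrite /lift /= rcons_path => /andP[].
- case=> [|b t]; first by rewrite mem_cat; apply/orP => -[] /mapP[].
  have other u r : (b :: t \in [seq u :: v | v <- r]) = (u == b) && (t \in r).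
    apply/mapP/andP => [[v vr [-> ->]]|[/eqP-> tr]] //.
    by exists t.
  rewrite mem_cat !other (perm_mem perm_w) [in X in _ || X]in_cons mem_s !inE.
  rewrite eqSS /=; case: b {other} => //=; last by rewrite orbF.
  rewrite andbT; have [size_t|size_t] := eqVneq (size t) n; last first.
    by rewrite orbF; apply: contra_neqF size_t => /eqP->; rewrite size_nseq.
  have [//|nt] := boolP (has id t); first by rewrite orbT.
  (* the remaining vertex is the singleton of the new element *)
  rewrite orbF -size_t; apply/eqP/all_pred1P.
  by rewrite -[all _ _]negbK -has_predC; apply: contra nt; apply: sub_has; case.
Qed.

(** The path [01, 11, 10] is the base case; its ends are disjoint. *)
Lemma exists_spans n : exists x s z, spans n.+2 (x :: rcons s z).
Proof.
elim: n => [|n [x [s [z sp]]]].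
  exists [:: false; true], [:: [:: true; true]], [:: true; false].
  by split=> // -[|[] [|[] [|? ?]]].
have := lift_spans sp; rewrite /lift !map_cons !map_rcons.
by rewrite -!rcons_cons -rcons_cat => sp'; do 3 eexists; exact: sp'.
Qed.

(** * Cycles and irreflexive relations *)

(** Consecutive entries of a duplicate-free cycle are distinct as soon as it has
two entries, so irreflexivity can be imposed on the relation afterwards. *)
Lemma cycle_neq (T : eqType) (e : rel T) (c : seq T) :
  (2 <= size c)%N -> uniq c -> cycle e c ->
  cycle [rel x y | (x != y) && e x y] c.
Proof.
case: c => [|x [|y c]] // _ uniq_c; rewrite [cycle _ _]/= => cyc.
apply: etrans (path_relI (fun x y => x != y) e _ _) _.
rewrite [X in _ && X]cyc andbT rcons_path.
move: (uniq_c); rewrite uniq_pairwise => /pairwise_sorted /= -> /=.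
move: uniq_c; rewrite cons_uniq => /andP[xNc _].
by apply: contraNneq xNc => <-; exact: mem_last.
Qed.

(** * Bit sequences as vectors *)

Section BitVectors.
Variables (F : fieldType) (V : vectType F) (n : nat) (alpha : n.-tuple V).
Hypothesis alpha_basis : basis_of {:V} alpha.

Definition bitvec (s : seq bool) : V :=
  \sum_(i < n) (nth false s i)%:R *: alpha`_i.

Lemma coord_bitvec s (i : 'I_n) : (coord alpha i (bitvec s) != 0) = nth false s i.
Proof.
rewrite coord_sum_free ?(basis_free alpha_basis) //.
by case: nth; rewrite ?oner_eq0 ?eqxx.
Qed.

Lemma bitvec_inj : {in [pred s | size s == n] &, injective bitvec}.
Proof.
move=> s t /eqP size_s /eqP size_t eq_st.
apply: (@eq_from_nth _ false) => [|i]; first by rewrite size_s.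
by rewrite size_s => lt_i; rewrite -!(coord_bitvec _ (Ordinal lt_i)) eq_st.
Qed.

Lemma meets_bitvec s t : size s = n -> size t = n -> meets s t ->
  [exists i, (coord alpha i (bitvec s) != 0) && (coord alpha i (bitvec t) != 0)].
Proof.
move=> size_s size_t /(has_nthP (false, false))[i].
rewrite size_zip size_s size_t minnn => lt_i; rewrite nth_zip ?size_s ?size_t //.
by move=> st_i; apply/existsP; exists (Ordinal lt_i); rewrite !coord_bitvec.
Qed.

Lemma bitvec_neq0 s : size s = n -> has id s -> bitvec s != 0.
Proof.
move=> size_s; rewrite -meetsxx => /(meets_bitvec size_s size_s) /existsP[i].
by apply: contraTneq => ->; rewrite linear0 eqxx.
Qed.

(** This is where the field has to be the one with two elements: a nonzero
coordinate is then [1]. *)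
Lemma bitvec_support (v : V) : (forall k : F, k != 0 -> k = 1) ->
  bitvec [seq coord alpha i v != 0 | i <- enum 'I_n] = v.
Proof.
move=> F2; rewrite [RHS](coord_basis alpha_basis (memvf v)).
apply: eq_bigr => i _; congr (_ *: _).
rewrite (nth_map i) ?size_enum_ord // nth_ord_enum.
by case: (eqVneq (coord alpha i v) 0) => [->|/F2].
Qed.

End BitVectors.

Lemma card2_eq1 (F : finFieldType) (k : F) : #|F| = 2%N -> k != 0 -> k = 1.
Proof.
move=> F2 k0; apply/eqP; apply/negPn/negP => k1.
have: (#|[set 0%R; 1%R; k]| <= #|F|)%N by exact: max_card.
by rewrite F2 setUC cardsU1 cards2 !inE negb_or k0 k1 eq_sym oner_eq0.
Qed.

Theorem theorem5p4 (F : finFieldType) (q : nat) (hF : #|F| = q)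
  (n : nat) (V : vectType F) (hdim : \dim {:V} = n)
  (alpha : n.-tuple V) (halpha : basis_of {:V} alpha)
  (hq : q = 2%N) (hn : (3 <= n)%N) :
  hamiltonian (component_adj alpha).
Proof.
have F2 (k : F) : k != 0 -> k = 1 by apply: card2_eq1; rewrite hF.
have [c [size_c cyc_c [uniq_c _ mem_c]]] : exists c,
    [/\ (3 <= size c)%N, cycle meets c & spans n c].
  case: n hn {hdim alpha halpha} => [|[|[|n]]] // _.
  have [x [s [z sp]]] := exists_spans n; exists (lift n.+2 x s z).
  split; [|exact: lift_cycle|exact: lift_spans].
  by rewrite size_cat !size_map /= !size_rcons addSn addnS.
have size_in s : s \in c -> size s = n by rewrite mem_c => /andP[/eqP].
have nz s : s \in c -> bitvec alpha s != 0.
  by rewrite mem_c => /andP[/eqP size_s /(bitvec_neq0 halpha size_s)].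
pose d : seq (nonnull V) := pmap insub (map (bitvec alpha) c).
have val_d : map val d = map (bitvec alpha) c.
  rewrite (pmap_filter (insubK _)); apply/all_filterP/allP => _ /mapP[s sc ->].
  by rewrite /= insubT ?nz.
have uniq_d : uniq d.
  rewrite -(map_inj_uniq val_inj) val_d map_inj_in_uniq //.
  by move=> s t /size_in/eqP ? /size_in/eqP ?; exact: bitvec_inj.
have size_d : size d = size c by rewrite -(size_map val) val_d size_map.
exists d; split; rewrite ?size_d //.
  apply: cycle_neq; rewrite ?size_d 1?ltnW //.
  pose adj (a b : V) :=
    [exists i : 'I_n, (coord alpha i a != 0) && (coord alpha i b != 0)].
  suff: cycle adj (map val d) by rewrite cycle_map.
  rewrite val_d cycle_map; apply: (sub_in_cycle (P := mem c)) cyc_c; last exact/allP.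
  by move=> s t /size_in ? /size_in ?; exact: meets_bitvec.
(* the cycle visits [v] when it visits the support of [v] *)
case=> v v0; rewrite mem_pmap_sub /=; apply/mapP.
set s := [seq coord alpha i v != 0 | i <- enum 'I_n].
exists s; last by rewrite bitvec_support.
rewrite mem_c inE size_map size_enum_ord eqxx /=.
apply: contraNT v0 => /hasPn s0; rewrite (coord_basis halpha (memvf v)).
rewrite big1 // => i _; have /s0 : (coord alpha i v != 0) \in s.
  by apply: map_f; rewrite mem_enum.
by rewrite negbK => /eqP->; rewrite scale0r.
Qed.
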